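(* Let $H=(V,E,C,\ell)$ be an edge-colored hypergraph with nonnegative edge weights $w$, and suppose that for each node $v$ the list of incident edges is given sorted by color. The algorithm \textsf{LocalRatioECC} described in the context outputs a set $D\subseteq E$ such that no two edges of $E\setminus D$ form a bad edge pair (so nodes can be colored so that every edge of $E\setminus D$ is satisfied), and $w(D)\le 2\,\mathrm{OPT}$, where $\mathrm{OPT}$ is the optimal value of \textsc{MinECC} on $H$; i.e., it is a 2-approximation algorithm for \textsc{MinECC}. Moreover it runs in $O(\sum_{v\in V} d_v)=O(\mu)$ time, where $d_v$ is the degree of $v$ and $\mu=\sum_{e\in E}|e|$.
   Context: An edge-colored hypergraph $H=(V,E,C,\ell)$ has node set $V$, hyperedge set $E$ (each $e\subseteq V$), color set $C=\{1,\dots,k\}$, and a map $\ell:E\to C$ giving each hyperedge a color; each edge has weight $w(e)\ge 0$, and $w(A)=\sum_{e\in A}w(e)$. In \textsc{MinECC} (minimum edge-colored clustering) one assigns each node a color; a hyperedge $e$ is satisfied if all its nodes receive color $\ell(e)$, otherwise unsatisfied; the goal is to minimize the total weight of unsatisfied edges. Equivalently, one deletes a minimum-weight set of edges so that no bad edge pair remains, where $(e,f)$ is a bad edge pair if $e\cap f\neq\emptyset$ and $\ell(e)\neq\ell(f)$. Let $E(v)$ be the set of edges containing $v$, $d_v=|E(v)|$. Algorithm \textsf{LocalRatioECC}: maintain current weights (initially $w(e)$) and a set $D=\emptyset$. For each $v\in V$ in turn: let $e_{v(1)},\dots,e_{v(d_v)}$ be the edges of $E(v)$ sorted by color in increasing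 order; set $f=1$, $b=d_v$; while $e_{v(b)}\in D$ and $b>f$, decrement $b$; while $e_{v(f)}\in D$ and $b>f$, increment $f$. Then, while $\ell(e_{v(f)})\neq\ell(e_{v(b)})$: if $w(e_{v(f)})<w(e_{v(b)})$, add $e_{v(f)}$ to $D$, set $w(e_{v(b)})\gets w(e_{v(b)})-w(e_{v(f)})$, and increment $f$ while $e_{v(f)}\in D$ and $b>f$; if $w(e_{v(f)})=w(e_{v(b)})$, add both $e_{v(f)},e_{v(b)}$ to $D$, increment $f$ while $e_{v(f)}\in D$ and $b>f$, then decrement $b$ while $e_{v(b)}\in D$ and $b>f$; otherwise add $e_{v(b)}$ to $D$, set $w(e_{v(f)})\gets w(e_{v(f)})-w(e_{v(b)})$, and decrement $b$ while $e_{v(b)}\in D$ and $b>f$. After processing all nodes, return $D$. (The approximation guarantee is with respect to the original weights.)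
   Formalization: The time bound O(sum of d_v) is stated for hypergraphs without isolated nodes, and in general as O(sum of d_v plus the number of isolated nodes), since looping over nodes of degree 0 already costs more than sum of d_v; correctness and the factor 2 hold for all hypergraphs. *)

(* Defs.v *)
From HB Require Import structures.
From mathcomp Require Import all_boot all_order all_algebra.

Set Implicit Arguments.
Unset Strict Implicit.
Unset Printing Implicit Defensive.

Import Order.TTheory GRing.Theory Num.Theory.
Local Open Scope ring_scope.

(* Hyperedges are indexed by a finite type, so parallel hyperedges are allowed;
   a set of subsets of V is the case where [ends] is injective. *)
Record hypergraph (R : realFieldType) (V E : finType) (k : nat) := Hypergraph {
  ends : E -> {set V};
  color : E -> 'I_k;
  weight : E -> R;
  ncolors_gt0 : (0 < k)%N;
  weight_ge0 : forall e, 0 <= weight e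
}.

Section MinECC.
Context (R : realFieldType) (V E : finType) (k : nat).
Variable H : hypergraph R V E k.

Definition incident (v : V) : {set E} := [set e | v \in ends H e].
Definition deg (v : V) : nat := #|incident v|.
Definition mu : nat := (\sum_(e : E) #|ends H e|)%N.
Definition wt (A : {set E}) : R := \sum_(e in A) weight H e.

Definition satisfied (phi : {ffun V -> 'I_k}) (e : E) : bool :=
  [forall v in ends H e, phi v == color H e].

Definition unsat_weight (phi : {ffun V -> 'I_k}) : R :=
  wt [set e | ~~ satisfied phi e].

Definition OPT : R :=
  unsat_weight
    [arg min_(phi < [ffun _ : V => Ordinal (ncolors_gt0 H)]) unsat_weight phi]%O.

Definition bad_pair (e f : E) : bool :=
  (ends H e :&: ends H f != set0) && (color H e != color H f).

Definition sorted_incidence (adj : V -> seq E) : Prop :=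
  forall v, [/\ uniq (adj v), adj v =i incident v &
    sorted (fun e f => (color H e <= color H f)%N) (adj v)].

End MinECC.

(* The algorithm is a program in a small imperative language with a unit-cost
   semantics: every instruction and every atomic test is a constant number of
   array accesses, comparisons and arithmetic operations (membership in D being
   a lookup in an array of marks) and is charged one time unit. *)

Inductive instr :=
| Init_f   (* f := 1 *)
| Init_b   (* b := d_v *)
| Incr_f
| Decr_b
| Del_f    (* add e_v(f) to D *)
| Del_b    (* add e_v(b) to D *)
| Sub_f    (* w(e_v(f)) := w(e_v(f)) - w(e_v(b)) *)
| Sub_b    (* w(e_v(b)) := w(e_v(b)) - w(e_v(f)) *).

Inductive test :=
| F_in_D   (* e_v(f) \in D *)
| B_in_D   (* e_v(b) \in D *)
| B_gt_F   (* b > f *)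
| Col_neq  (* color e_v(f) <> color e_v(b) *)
| Wt_lt    (* w(e_v(f)) < w(e_v(b)) *)
| Wt_eq    (* w(e_v(f)) = w(e_v(b)) *).

(* A loop guard is a conjunction of atomic tests. *)
Inductive cmd :=
| Do of instr
| Seq of cmd & cmd
| If of test & cmd & cmd
| While of seq test & cmd.

Declare Scope cmd_scope.
Delimit Scope cmd_scope with cmd.
Bind Scope cmd_scope with cmd.
Notation "c1 ;; c2" := (Seq c1 c2)
  (at level 100, c2 at level 200, right associativity) : cmd_scope.

Definition advance_f : cmd := While [:: F_in_D; B_gt_F] (Do Incr_f).
Definition retreat_b : cmd := While [:: B_in_D; B_gt_F] (Do Decr_b).

Definition process_node : cmd :=
  (Do Init_f ;; Do Init_b ;;
   retreat_b ;;
   advance_f ;;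
   While [:: Col_neq]
     (If Wt_lt
        (Do Del_f ;; Do Sub_b ;; advance_f)
     (If Wt_eq
        (Do Del_f ;; Do Del_b ;; advance_f ;; retreat_b)
        (Do Del_b ;; Do Sub_f ;; retreat_b))))%cmd.

Section Semantics.
Context (R : realFieldType) (V E : finType) (k : nat).
Variable H : hypergraph R V E k.

Record state := State {
  del : {set E};
  cur : E -> R;    (* current weights *)
  ptr_f : nat;
  ptr_b : nat
}.

Section Node.
Variable s : seq E.   (* the list e_v(1), ..., e_v(d_v) of the current node v *)

(* Pointers are 1-based. A lookup yields None only if d_v = 0; then every test
   below is false, and the node is left without any effect on D and weights. *)
Definition at_ptr (i : nat) : option E := onth s i.-1.
Definition ef (st : state) := at_ptr (ptr_f st).
Definition eb (st : state) := at_ptr (ptr_b st).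

Definition mark (o : option E) (st : state) : state :=
  if o is Some e then State (e |: del st) (cur st) (ptr_f st) (ptr_b st)
  else st.

Definition decrease (o o' : option E) (st : state) : state :=
  if (o, o') is (Some e, Some e') then
    State (del st) [eta cur st with e |-> cur st e - cur st e']
          (ptr_f st) (ptr_b st)
  else st.

Definition do_instr (i : instr) (st : state) : state :=
  match i with
  | Init_f => State (del st) (cur st) 1 (ptr_b st)
  | Init_b => State (del st) (cur st) (ptr_f st) (size s)
  | Incr_f => State (del st) (cur st) (ptr_f st).+1 (ptr_b st)
  | Decr_b => State (del st) (cur st) (ptr_f st) (ptr_b st).-1
  | Del_f => mark (ef st) st
  | Del_b => mark (eb st) st
  | Sub_f => decrease (ef st) (eb st) st
  | Sub_b => decrease (eb st) (ef st) st
  end.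

Definition eval (t : test) (st : state) : bool :=
  match t with
  | F_in_D => if ef st is Some e then e \in del st else false
  | B_in_D => if eb st is Some e then e \in del st else false
  | B_gt_F => (ptr_f st < ptr_b st)%N
  | Col_neq => if (ef st, eb st) is (Some e, Some e')
               then color H e != color H e' else false
  | Wt_lt => if (ef st, eb st) is (Some e, Some e')
             then cur st e < cur st e' else false
  | Wt_eq => if (ef st, eb st) is (Some e, Some e')
             then cur st e == cur st e' else false
  end.

Definition holds (g : seq test) (st : state) : bool :=
  all (fun t => eval t st) g.

(* [exec c st st' n]: started in st, c terminates in st' after n time units. *)
Inductive exec : cmd -> state -> state -> nat -> Prop :=
| exec_do i st :
    exec (Do i) st (do_instr i st) 1
| exec_seq c1 c2 st st1 st2 n1 n2 :
    exec c1 st st1 n1 -> exec c2 st1 st2 n2 ->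
    exec (Seq c1 c2) st st2 (n1 + n2)
| exec_if t c1 c2 st st' n :
    exec (if eval t st then c1 else c2) st st' n ->
    exec (If t c1 c2) st st' n.+1
| exec_while_done g c st :
    ~~ holds g st -> exec (While g c) st st (size g)
| exec_while_step g c st st1 st2 n1 n2 :
    holds g st -> exec c st st1 n1 -> exec (While g c) st1 st2 n2 ->
    exec (While g c) st st2 (size g + n1 + n2).

End Node.

(* Moving to the next node of the list costs one time unit as well. *)
Inductive exec_nodes (adj : V -> seq E) : seq V -> state -> state -> nat -> Prop :=
| exec_nil st : exec_nodes adj [::] st st 0
| exec_cons v vs st st1 st2 n1 n2 :
    exec (adj v) process_node st st1 n1 -> exec_nodes adj vs st1 st2 n2 ->
    exec_nodes adj (v :: vs) st st2 (n1 + n2).+1.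

(* The initial pointer values are irrelevant: process_node resets them. *)
Definition init_state : state := State set0 (weight H) 1 0.

Definition LocalRatioECC (vs : seq V) (adj : V -> seq E) (D : {set E}) (t : nat)
  : Prop :=
  exists2 st, exec_nodes adj vs init_state st t & D = del st.

End Semantics.

(* Main.v *)
Require Import Defs.
From HB Require Import structures.
From mathcomp Require Import all_boot all_order all_algebra.
From mathcomp Require Import zify lra.
Import Order.TTheory GRing.Theory Num.Theory.
Local Open Scope ring_scope.

Set Implicit Arguments.
Unset Strict Implicit.
Unset Printing Implicit Defensive.

(** Local ratio argument.  Each round of the main loop picks two surviving edges
    of different colors at the current node and lowers both of their weights by
    the smaller one, a deleted edge counting as having weight 0.  Every coloring
    leaves one of the two edges unsatisfied, so the total weight removed is at
    most twice the weight removed from the unsatisfied edges of any coloring.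
    Since a deleted edge has lost all of its weight, [w(D) <= 2 OPT].  When the
    loop stops, all edges outside the window [f..b] are deleted and the ends of
    the window have the same color, so by sortedness the surviving edges at the
    node are monochromatic.  Every round moves a pointer, hence linear time. *)

(** * Determinism of the cost semantics *)

Section Determinism.
Context {R : realFieldType} {V E : finType} {k : nat} (H : hypergraph R V E k).

(** The guarantee concerns every run, while the proof below constructs a single one; determinism
    transfers its final state and cost to all others. *)
Lemma exec_det s c st st1 n1 st2 n2 :
  exec H s c st st1 n1 -> exec H s c st st2 n2 -> st1 = st2 /\ n1 = n2.
Proof.
move=> ex1; elim: ex1 st2 n2 => {c st st1 n1}.
- by move=> i st st2 n2 ex2; inversion ex2.
- move=> c1 c2 st st1 st1' n1 n1' _ IH1 _ IH2 st2 n2 ex2.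
  inversion ex2 as [|? ? ? ? ? ? ? exA exB| | |]; subst.
  by case: (IH1 _ _ exA) => ? ?; subst; case: (IH2 _ _ exB) => -> ->.
- move=> t c1 c2 st st' n _ IH st2 n2 ex2.
  inversion ex2 as [| |? ? ? ? ? ? exA| |]; subst.
  by case: (IH _ _ exA) => -> ->.
- move=> g c st ng st2 n2 ex2.
  inversion ex2 as [| | | |? ? ? ? ? ? ? gst]; subst => //.
  by rewrite gst in ng.
- move=> g c st st1 st1' n1 n1' gst _ IH1 _ IH2 st2 n2 ex2.
  inversion ex2 as [| | |? ? ? ng|? ? ? ? ? ? ? _ exA exB]; subst.
    by rewrite gst in ng.
  by case: (IH1 _ _ exA) => ? ?; subst; case: (IH2 _ _ exB) => -> ->.
Qed.

Lemma exec_nodes_det adj vs st st1 n1 st2 n2 :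
  exec_nodes H adj vs st st1 n1 -> exec_nodes H adj vs st st2 n2 ->
  st1 = st2 /\ n1 = n2.
Proof.
move=> ex1; elim: ex1 st2 n2 => {vs st st1 n1}.
- by move=> st st2 n2 ex2; inversion ex2.
- move=> v vs st st1 st1' n1 n1' ex1 _ IH st2 n2 ex2.
  inversion ex2 as [|? ? ? ? ? ? ? exA exB]; subst.
  by case: (exec_det ex1 exA) => ? ?; subst; case: (IH _ _ exB) => -> ->.
Qed.

End Determinism.

(** * Local ratio accounting of the removed weight *)

Section LocalRatio.
Context {R : realFieldType} {V E : finType} {k : nat} (H : hypergraph R V E k).

(** Deleting an edge leaves a stale value in [cur], so the remaining weight has to be read off
    together with [D]. *)
Definition residual (D : {set E}) (w : E -> R) (e : E) : R :=
  if e \in D then 0 else w e.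

Definition paid (D : {set E}) (w : E -> R) (e : E) : R :=
  weight H e - residual D w e.

(** Quantifying over every [phi] keeps optimality out of the induction; the pointwise bounds make
    each payment nonnegative. *)
Definition ratio_inv (D : {set E}) (w : E -> R) : Prop :=
  (forall e, 0 <= w e <= weight H e) /\
  (forall phi, \sum_e paid D w e
     <= 2 * \sum_(e | ~~ satisfied H phi e) paid D w e).

Lemma ratio_inv_init : ratio_inv set0 (weight H).
Proof.
have paid0 e : paid set0 (weight H) e = 0 by rewrite /paid /residual inE subrr.
split=> [e|phi]; first by rewrite weight_ge0 lexx.
by rewrite !big1 ?mulr0 // => e _; rewrite paid0.
Qed.

Lemma satisfied_color phi v e :
  v \in ends H e -> satisfied H phi e -> phi v = color H e.
Proof. by move=> ve /forallP/(_ v); rewrite ve => /eqP. Qed.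

Lemma unsat_bad_pair phi v e f :
  v \in ends H e -> v \in ends H f -> color H e != color H f ->
  ~~ satisfied H phi e || ~~ satisfied H phi f.
Proof.
move=> ve vf; apply: contraNT; rewrite negb_or !negbK => /andP[se sf].
by rewrite -(satisfied_color ve se) -(satisfied_color vf sf).
Qed.

Lemma sum_indicator (P : pred E) (d : R) e :
  \sum_(x | P x) d *+ (x == e) = d *+ P e.
Proof.
rewrite big_mkcond (bigD1 e) //= eqxx big1 ?addr0 => [|x /negPf->].
  by case: (P e).
by case: ifP.
Qed.

(* A bad pair contains an edge left unsatisfied by any coloring, so charging
   [d] to both of its edges costs [2 d] in total and at least [d] on the
   unsatisfied ones. *)
Lemma ratio_inv_charge D w D' w' d v e f :
  ratio_inv D w -> v \in ends H e -> v \in ends H f ->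
  color H e != color H f -> 0 <= d ->
  (forall x, 0 <= w' x <= weight H x) ->
  (forall x, residual D' w' x
     = residual D w x - (d *+ (x == e) + d *+ (x == f))) ->
  ratio_inv D' w'.
Proof.
move=> [_ inv] ve vf cef d0 w'P resE; split=> // phi.
have sumE (P : pred E) : \sum_(x | P x) paid D' w' x
    = \sum_(x | P x) paid D w x + (d *+ P e + d *+ P f).
  rewrite -!sum_indicator -!big_split; apply: eq_bigr => x _ /=.
  by rewrite /paid resE; lra.
rewrite !sumE /=; have := inv phi.
have := unsat_bad_pair phi ve vf cef.
by case: satisfied; case: satisfied => //= _; rewrite ?mulr0n ?mulr1n; lra.
Qed.

(** Deleted edges have paid their full weight and the others a nonnegative amount, so [wt H D] is at
    most the total paid. No edge pays more than its weight, so the unsatisfied edges pay at most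
    [unsat_weight H phi]. *)
Lemma ratio_inv_bound D w phi :
  ratio_inv D w -> wt H D <= 2 * unsat_weight H phi.
Proof.
move=> [wP /(_ phi) inv].
have res_ge0 e : 0 <= residual D w e.
  by rewrite /residual; case: ifP => // _; case/andP: (wP e).
have paid_ge0 e : 0 <= paid D w e.
  rewrite subr_ge0 /residual; case: ifP => _; first exact: weight_ge0.
  by case/andP: (wP e).
have wtD : wt H D <= \sum_e paid D w e.
  rewrite /wt [leRHS](bigID (mem D)) /= -[leLHS]addr0.
  apply: lerD; last exact: sumr_ge0.
  by apply: ler_sum => e eD; rewrite /paid /residual eD subr0.
apply: le_trans wtD (le_trans inv _); rewrite ler_wpM2l //.
rewrite /unsat_weight /wt [leRHS](eq_bigl (fun e => ~~ satisfied H phi e)).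
  by apply: ler_sum => e _; rewrite /paid lerBlDr lerDl.
by move=> e; rewrite inE.
Qed.

End LocalRatio.

(** * Pointer movement and cost at one node *)

Section Node.
Context {R : realFieldType} {V E : finType} {k : nat} (H : hypergraph R V E k).
Variable s : seq E.

Definition marked (D : {set E}) (i : nat) : bool :=
  if at_ptr s i is Some e then e \in D else false.

Lemma marked_sub (D D' : {set E}) i : D \subset D' -> marked D i -> marked D' i.
Proof. by move=> /subsetP sDD'; rewrite /marked; case: at_ptr => // e /sDD'. Qed.

Lemma at_ptr_nth e0 i : (0 < i <= size s)%N -> at_ptr s i = Some (nth e0 s i.-1).
Proof.
by move=> ile; rewrite /at_ptr onthE (nth_map e0) //; lia.
Qed.

Lemma exec_do_eq i st st' : do_instr s i st = st' -> exec H s (Do i) st st' 1.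
Proof. by move<-; exact: exec_do. Qed.

(** Each pass costs two tests and a decrement, and the final failing guard costs two more. The
    [minn f b] lets the induction on [b] run without assuming [f <= b]. *)
Lemma retreat_b_exec D w f b : exists b',
  [/\ exec H s retreat_b (State D w f b) (State D w f b') (2 + 3 * (b - b')),
      (minn f b <= b' <= b)%N, (f < b')%N -> ~~ marked D b'
    & forall i, (b' < i <= b)%N -> marked D i].
Proof.
elim: b => [|b [b' [ex le stop mk]]].
  exists 0%N; split=> //; last by lia.
  by apply: exec_while_done; rewrite /holds /= andbF.
have [gd|ngd] := boolP (holds H s [:: B_in_D; B_gt_F] (State D w f b.+1)).
  have [mb fb] : marked D b.+1 /\ (f < b.+1)%N by case/and3P: gd.
  exists b'; split=> //; last 2 first.
  - lia.
  - move=> i ib; have [->//|ne] := eqVneq i b.+1.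
    by apply: mk; lia.
  - have -> : (2 + 3 * (b.+1 - b') = 2 + 1 + (2 + 3 * (b - b')))%N by lia.
    by apply: exec_while_step ex => //; exact: exec_do.
exists b.+1; split; [|lia| |lia].
  by rewrite subnn; apply: exec_while_done.
by move=> fb; apply: contra ngd => mb; rewrite /holds /= fb !andbT.
Qed.

Lemma advance_f_exec D w f b : exists f',
  [/\ exec H s advance_f (State D w f b) (State D w f' b) (2 + 3 * (f' - f)),
      (f <= f' <= maxn f b)%N, (f' < b)%N -> ~~ marked D f'
    & forall i, (f <= i < f')%N -> marked D i].
Proof.
have [m] := ubnP (b - f); elim: m f => // m IH f ltm.
have [gd|ngd] := boolP (holds H s [:: F_in_D; B_gt_F] (State D w f b)).
  have [mf fb] : marked D f /\ (f < b)%N by case/and3P: gd.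
  have [|f' [ex le stop mk]] := IH f.+1; first by lia.
  exists f'; split=> //; last 2 first.
  - lia.
  - move=> i ib; have [->//|ne] := eqVneq i f.
    by apply: mk; lia.
  - have -> : (2 + 3 * (f' - f) = 2 + 1 + (2 + 3 * (f' - f.+1)))%N by lia.
    by apply: exec_while_step ex => //; exact: exec_do.
exists f; split; [|lia| |lia].
  by rewrite subnn; apply: exec_while_done.
by move=> fb; apply: contra ngd => mb; rewrite /holds /= fb !andbT.
Qed.

(** Window of positions that may still hold surviving edges. A window shrunk to one position may
    hold a deleted edge, since the pointer loops stop at [f = b]; hence the guard [f < b] on the
    third clause. *)
Definition ptr_inv (D : {set E}) (f b : nat) : Prop :=
  [/\ (0 < f <= b)%N, (b <= size s)%N,
      (f < b)%N -> ~~ marked D f /\ ~~ marked D b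
    & forall i, (0 < i <= size s)%N -> ~~ (f <= i <= b)%N -> marked D i].

(** Serves all three branches of the loop body: the two with unequal weights are the cases [b' = b]
    and [f' = f]. *)
Lemma ptr_inv_step (D D' : {set E}) f b f' b' :
  ptr_inv D f b -> D \subset D' -> (f <= f' <= b)%N ->
  (forall i, (f <= i < f')%N -> marked D' i) ->
  ((f' < b')%N -> ~~ marked D' f') ->
  (minn f' b <= b' <= b)%N -> ((f' < b')%N -> ~~ marked D' b') ->
  (forall i, (b' < i <= b)%N -> marked D' i) -> ptr_inv D' f' b'.
Proof.
move=> [f0b bs _ out] sDD' lef mkf stf leb stb mkb.
split; [by move: f0b lef leb; clear; lia | by move: bs leb; clear; lia | by auto |].
move=> i is_ iout; have [iin|/(out i is_)] := boolP (f <= i <= b)%N; last first.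
  exact: marked_sub.
have [lti|gei] := ltnP i f'; [apply: mkf|apply: mkb].
  by move: iin lti; clear; lia.
by move: iin iout gei; clear; lia.
Qed.

Definition loop_body : cmd :=
  (If Wt_lt
     (Do Del_f ;; Do Sub_b ;; advance_f)
  (If Wt_eq
     (Do Del_f ;; Do Del_b ;; advance_f ;; retreat_b)
     (Do Del_b ;; Do Sub_f ;; retreat_b)))%cmd.

Variable v : V.
Hypothesis s_inc : s =i incident H v.

(** The potential [12 * (b - f)] pays for the round. The costliest branch, that of equal weights,
    takes [8 + 3 * m] units when the pointers move [m >= 1] positions in all, and the strict
    inequality leaves one unit for the loop guard: [8 + 3 + 1 = 12]. *)
Lemma loop_body_exec D w f b :
  ptr_inv D f b -> ratio_inv H D w ->
  holds H s [:: Col_neq] (State D w f b) ->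
  exists D' w' f' b' n,
  [/\ exec H s loop_body (State D w f b) (State D' w' f' b') n,
      ptr_inv D' f' b', ratio_inv H D' w', D \subset D'
    & (n + 12 * (b' - f') < 12 * (b - f))%N].
Proof.
move=> pinv inv /andP[]; have [f0b bs unmarked _] := pinv; rewrite /= /ef /eb /=.
case Ef: (at_ptr s f) => [e|//]; case Eb: (at_ptr s b) => [e'|//] cee' _.
have flb : (f < b)%N.
  rewrite ltn_neqAle; case/andP: f0b => _ ->; rewrite andbT.
  by apply: contraNneq cee' => fb; move: Eb; rewrite -fb Ef => -[->].
have [] := unmarked flb; rewrite /marked Ef Eb => eD e'D.
have ptrP i x : at_ptr s i = Some x -> v \in ends H x.
  rewrite /at_ptr => ix; have : x \in s by apply/onthP; exists i.-1.
  by rewrite s_inc inE.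
have [ve ve'] := (ptrP _ _ Ef, ptrP _ _ Eb).
have nee' : e != e' by apply: contraNneq cee' => ->.
have [wP _] := inv.
have [/andP[we0 we1] /andP[we'0 we'1]] := (wP e, wP e').
have step := ptr_inv_step pinv.
have [lt|ge] := ltrP (w e) (w e').
  pose D' := e |: D; pose w' := [eta w with e' |-> w e' - w e].
  have [f' [ex lef stf mkf]] := advance_f_exec D' w' f b.
  rewrite (maxn_idPr (ltnW flb)) in lef.
  have e'D' : ~~ marked D' b.
    by rewrite /marked Eb !inE negb_or eq_sym nee'.
  have mf : marked D' f by rewrite /marked Ef !inE eqxx.
  (* The edge at [f] has just been deleted, whereas stopping below [b] requires an unmarked
     position; hence [f] moves. *)
  have ltf : (f < f')%N.
    rewrite ltn_neqAle; case/andP: lef => -> _; rewrite andbT.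
    by apply: contraTneq mf => ff'; rewrite ff' stf // -ff'.
  exists D', w', f', b, (1 + (1 + (2 + 3 * (f' - f)))).+1%N; split.
  - apply: exec_if; rewrite /= /ef /eb /= Ef Eb lt.
    apply: exec_seq; first by apply: exec_do_eq; rewrite /= /ef /= Ef.
    apply: exec_seq ex; apply: exec_do_eq.
    by rewrite /= /ef /eb /= Ef Eb.
  - apply: (step _ f' b) => //; first exact: subsetUr.
      by rewrite geq_minr leqnn.
    by move=> i; clear; lia.
  - apply: (ratio_inv_charge (d := w e) inv ve ve' cee' we0).
      by move=> x /=; case: eqP => [->|_]; [lra|exact: wP].
    move=> x; rewrite /residual !inE /=.
    have [->|ne] := eqVneq x e; first by rewrite (negPf nee') (negPf eD) /=; lra.
    have [->|ne'] := eqVneq x e'; first by rewrite (negPf e'D) /=; lra.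
    by rewrite /=; lra.
  - exact: subsetUr.
  - by move: ltf lef; clear; lia.
have [eq|ne] := eqVneq (w e) (w e').
  pose D' := e' |: (e |: D).
  have [f' [exf lef stf mkf]] := advance_f_exec D' w f b.
  rewrite (maxn_idPr (ltnW flb)) in lef.
  have [b' [exb leb stb mkb]] := retreat_b_exec D' w f' b.
  have mf : marked D' f by rewrite /marked Ef !inE eqxx orbT.
  have ltf : (f < f')%N.
    rewrite ltn_neqAle; case/andP: lef => -> _; rewrite andbT.
    by apply: contraTneq mf => ff'; rewrite ff' stf // -ff'.
  have sDD' : D \subset D' by rewrite /D' setUA subsetUr.
  exists D', w, f', b',
    (1 + (1 + ((2 + 3 * (f' - f)) + (2 + 3 * (b - b'))))).+2%N; split.
  - apply: exec_if; rewrite /= /ef /eb /= Ef Eb ltNge ge /=.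
    apply: exec_if; rewrite /= /ef /eb /= Ef Eb eq eqxx.
    apply: exec_seq; first by apply: exec_do_eq; rewrite /= /ef /= Ef.
    apply: exec_seq; first by apply: exec_do_eq; rewrite /= /eb /= Eb.
    exact: exec_seq exf exb.
  - apply: step => // f'b'; apply: stf.
    by case/andP: leb => _; exact: leq_trans.
  (* The weights stay as they are: since [w e = w e'], the two deletions alone lower both residuals
     by [w e]. *)
  - apply: (ratio_inv_charge (d := w e) inv ve ve' cee' we0 wP).
    move=> x; rewrite /residual !inE.
    have [->|ne] := eqVneq x e; first by rewrite (negPf nee') (negPf eD) /=; lra.
    have [->|ne'] := eqVneq x e'; first by rewrite (negPf e'D) eq /=; lra.
    by rewrite /=; lra.
  - by [].
  - by move: ltf lef leb; clear; lia.
pose D' := e' |: D; pose w' := [eta w with e |-> w e - w e'].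
have [b' [ex leb stb mkb]] := retreat_b_exec D' w' f b.
have eD' : ~~ marked D' f by rewrite /marked Ef !inE negb_or nee'.
have mb : marked D' b by rewrite /marked Eb !inE eqxx.
have ltb : (b' < b)%N.
  rewrite ltn_neqAle; case/andP: leb => _ ->; rewrite andbT.
  by apply: contraTneq mb => bb'; rewrite -bb' stb // bb'.
exists D', w', f, b', (1 + (1 + (2 + 3 * (b - b')))).+2%N; split.
- apply: exec_if; rewrite /= /ef /eb /= Ef Eb ltNge ge /=.
  apply: exec_if; rewrite /= /ef /eb /= Ef Eb (negPf ne).
  apply: exec_seq; first by apply: exec_do_eq; rewrite /= /eb /= Eb.
  apply: exec_seq ex; apply: exec_do_eq.
  by rewrite /= /ef /eb /= Ef Eb.
- apply: (step _ f b') => //; first exact: subsetUr.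
    by rewrite leqnn ltnW.
  by move=> i; clear; lia.
- apply: (ratio_inv_charge (d := w e') inv ve ve' cee' we'0).
    by move=> x /=; case: eqP => [->|_]; [lra|exact: wP].
  move=> x; rewrite /residual !inE /=.
  have [->|nex] := eqVneq x e; first by rewrite (negPf nee') (negPf eD) /=; lra.
  have [->|ne'] := eqVneq x e'; first by rewrite (negPf e'D) /=; lra.
  by rewrite /=; lra.
- exact: subsetUr.
- by move: ltb leb flb; clear; lia.
Qed.

Lemma main_loop_exec D w f b :
  ptr_inv D f b -> ratio_inv H D w ->
  exists D' w' f' b' n,
  [/\ exec H s (While [:: Col_neq] loop_body) (State D w f b)
        (State D' w' f' b') n,
      ptr_inv D' f' b' /\ ~~ holds H s [:: Col_neq] (State D' w' f' b'),
      ratio_inv H D' w', D \subset D' & (n <= 12 * (b - f) + 1)%N].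
Proof.
have [m] := ubnP (b - f); elim: m D w f b => // m IH D w f b ltm pinv inv.
have [gd|ngd] := boolP (holds H s [:: Col_neq] (State D w f b)); last first.
  by exists D, w, f, b, 1%N; split=> //; [exact: exec_while_done|lia].
have [D1 [w1 [f1 [b1 [n1 [ex1 pinv1 inv1 sD1 le1]]]]]] :=
  loop_body_exec pinv inv gd.
have [|D2 [w2 [f2 [b2 [n2 [ex2 pinv2 inv2 sD2 le2]]]]]] := IH _ _ _ _ _ pinv1 inv1.
  lia.
exists D2, w2, f2, b2, (1 + n1 + n2)%N; split=> //.
- exact: exec_while_step gd ex1 ex2.
- exact: subset_trans sD1 sD2.
- lia.
Qed.

Hypothesis s_sorted : sorted (fun e f => (color H e <= color H f)%N) s.

Lemma ptr_inv_monochromatic D w f b :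
  ptr_inv D f b -> ~~ holds H s [:: Col_neq] (State D w f b) ->
  {in s &, forall x y, x \notin D -> y \notin D -> color H x = color H y}.
Proof.
move=> [f0b bs _ out] stop x y xs ys xD yD.
have tr : transitive (fun e f => (color H e <= color H f)%N).
  by move=> ? ? ?; exact: leq_trans.
(* Surviving edges lie in the window; [index] is 0-based and the pointers are 1-based, hence the
   successor. *)
have range z : z \in s -> z \notin D -> (f <= (index z s).+1 <= b)%N.
  move=> zs zD; apply: contraR zD => /out; rewrite /= index_mem => /(_ zs).
  by rewrite /marked (at_ptr_nth z) /= ?index_mem // nth_index.
have le := sorted_leq_nth tr (fun e => leqnn (color H e)) x s_sorted.
move: stop; rewrite /holds /= /ef /eb /= !(at_ptr_nth x) ?andbT ?negbK; [|lia|lia].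
move=> /eqP cfb.
suff col z : z \in s -> z \notin D -> color H z = color H (nth x s f.-1).
  by rewrite !col.
move=> zs zD; have /andP[fz zb] := range z zs zD.
have zi : (index z s < size s)%N by rewrite index_mem.
(* Sortedness squeezes the color of [z] between the colors at [f] and [b], which [cfb]
   identifies. *)
apply/val_inj/eqP; rewrite eqn_leq /= {1}cfb.
rewrite -(nth_index x zs) !le // ?inE; move: f0b bs fz zb zi; clear; lia.
Qed.

Lemma process_node_exec st : ratio_inv H (del st) (cur st) ->
  exists st' n,
  [/\ exec H s process_node st st' n, ratio_inv H (del st') (cur st'),
      del st \subset del st', (n <= 12 * size s + 7)%N
    & {in s &, forall x y, x \notin del st' -> y \notin del st' ->
        color H x = color H y}].
Proof.
case: st => D w f0 b0 /= inv.
(* With no incident edge, [f = 1] and [b = 0] violate [ptr_inv], so the run is traced by hand: two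
   initializations and failing guards of sizes 2, 2 and 1, in all 7 units. The same fixed costs give
   the additive 7 in general. *)
have [s0|s_gt0] := posnP (size s).
  have sE : s = [::] by apply: size0nil.
  exists (State D w 1 0), 7%N; split=> //; [|exact: leq_addl|by rewrite sE].
  have nil_ptr i : at_ptr s i = None by rewrite sE /at_ptr; case: i.-1.
  apply: (@exec_seq _ _ _ _ _ _ _ _ _ _ _ 1 6); first exact: exec_do.
  apply: (@exec_seq _ _ _ _ _ _ _ _ _ (State D w 1 0) _ 1 5).
    by apply: exec_do_eq; rewrite /= s0.
  apply: (@exec_seq _ _ _ _ _ _ _ _ _ (State D w 1 0) _ 2 3).
    by apply: exec_while_done; rewrite /holds /= /eb nil_ptr.
  apply: (@exec_seq _ _ _ _ _ _ _ _ _ (State D w 1 0) _ 2 1).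
    by apply: exec_while_done; rewrite /holds /= /ef nil_ptr.
  by apply: exec_while_done; rewrite /holds /= /ef nil_ptr.
have [b [exb leb stb mkb]] := retreat_b_exec D w 1 (size s).
have [f [exf lef stf mkf]] := advance_f_exec D w 1 b.
rewrite (minn_idPl s_gt0) in leb; have [b_gt0 bs] := andP leb.
rewrite (maxn_idPr b_gt0) in lef; have [f_gt0 fb] := andP lef.
have pinv : ptr_inv D f b.
  split=> [||ltfb|i /andP[i_gt0 is_] iout].
  - exact/andP.
  - exact: bs.
  - by split; [exact: stf|apply: stb; exact: leq_ltn_trans ltfb].
  - have [lti|gei] := ltnP i f; [apply: mkf|apply: mkb]; first exact/andP.
    by rewrite gei -ltnNge in iout; exact/andP.
have [D' [w' [f' [b' [n [ex [pinv' stop] inv' sDD' len]]]]]] :=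
  main_loop_exec pinv inv.
exists (State D' w' f' b'),
  (1 + (1 + ((2 + 3 * (size s - b)) + ((2 + 3 * (f - 1)) + n))))%N.
split=> //=; last exact: ptr_inv_monochromatic pinv' stop.
- apply: exec_seq; first exact: exec_do.
  apply: exec_seq; first exact: exec_do.
  by apply: exec_seq exb _; apply: exec_seq exf ex.
- lia.
Qed.

End Node.

(** * From single nodes to the whole run and the final coloring *)

Section Correctness.
Context {R : realFieldType} {V E : finType} {k : nat} (H : hypergraph R V E k).
Variable adj : V -> seq E.
Hypothesis adjP : sorted_incidence H adj.

(** Deletions are never undone, so what is reached at one node survives the processing of later
    ones. The [8] is the 7 fixed units of a node plus one for moving to it. *)
Lemma exec_nodes_correct vs st : ratio_inv H (del st) (cur st) ->
  exists st' n,
  [/\ exec_nodes H adj vs st st' n, ratio_inv H (del st') (cur st'),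
      del st \subset del st', (n <= \sum_(v <- vs) (12 * deg H v + 8))%N
    & {in vs, forall v, {in incident H v &, forall x y,
        x \notin del st' -> y \notin del st' -> color H x = color H y}}].
Proof.
elim: vs st => [|v vs IH] st inv.
  by exists st, 0%N; split=> //; exact: exec_nil.
have [adj_uniq adj_inc adj_sorted] := adjP v.
have [st1 [n1 [ex1 inv1 sub1 le1 mono1]]] :=
  process_node_exec adj_inc adj_sorted inv.
have [st2 [n2 [ex2 inv2 sub2 le2 mono2]]] := IH _ inv1.
have szE : size (adj v) = deg H v.
  by rewrite /deg -(eq_card adj_inc); apply/esym/card_uniqP.
exists st2, (n1 + n2).+1; split=> //.
- exact: exec_cons ex1 ex2.
- exact: subset_trans sub1 sub2.
- by rewrite big_cons -szE; lia.
- move=> u; rewrite inE => /predU1P[->|/mono2//] x y xv yv xD yD.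
  apply: mono1; rewrite ?adj_inc //.
    by apply: contra xD; apply: (subsetP sub2).
  by apply: contra yD; apply: (subsetP sub2).
Qed.

(** Double counting of the node-edge incidences. *)
Lemma sum_deg : (\sum_(v : V) deg H v)%N = mu H.
Proof.
rewrite /mu; under eq_bigr do rewrite /deg -sum1_card big_mkcond.
rewrite exchange_big; apply: eq_bigr => e _.
by rewrite -sum1_card [RHS]big_mkcond; apply: eq_bigr => v _; rewrite inE.
Qed.

Lemma monochromatic_coloring (D : {set E}) :
  (forall v, {in incident H v &, forall x y,
     x \notin D -> y \notin D -> color H x = color H y}) ->
  exists phi : {ffun V -> 'I_k}, forall e, e \notin D -> satisfied H phi e.
Proof.
move=> mono.
(* Any surviving incident edge may give the color, since all of them agree by [mono]; a node without
   one gets color 0 as a default. *)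
exists [ffun v => if [pick e in incident H v :\: D] is Some e then color H e
                  else Ordinal (ncolors_gt0 H)].
move=> e eD; apply/forallP => v; apply/implyP => ve; rewrite ffunE.
case: pickP => [x|/(_ e)]; rewrite !inE ?eD ?ve //.
by move=> /andP[xD vx]; apply/eqP/(mono v); rewrite ?inE.
Qed.

End Correctness.

Theorem theorem1 :
  exists c : nat,
  forall (R : realFieldType) (V E : finType) (k : nat)
         (H : hypergraph R V E k) (vs : seq V) (adj : V -> seq E),
  perm_eq vs (enum V) ->
  sorted_incidence H adj ->
  [/\ exists (D : {set E}) (t : nat), LocalRatioECC H vs adj D t,
      forall (D : {set E}) (t : nat), LocalRatioECC H vs adj D t ->
        [/\ forall e f : E, e \notin D -> f \notin D -> ~~ bad_pair H e f,
            exists phi : {ffun V -> 'I_k},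
              forall e : E, e \notin D -> satisfied H phi e,
            wt H D <= 2 * OPT H,
            (forall v : V, (0 < deg H v)%N) ->
              (t <= c * \sum_(v : V) deg H v)%N
          & (t <= c * (\sum_(v : V) deg H v + #|[set v | deg H v == 0%N]|))%N]
    & (\sum_(v : V) deg H v)%N = mu H].
Proof.
(* [20 = 12 + 8]: a node of degree [d >= 1] costs at most [12 * d + 8 <= 20 * d], and one of degree
   0 costs at most 8, charged to the count of isolated nodes. *)
exists 20%N => R V E k H vs adj vsV adjP.
have [st [n [ex inv _ len mono]]] :=
  exec_nodes_correct adjP vs (st := init_state H) (ratio_inv_init H).
have {}mono v : {in incident H v &, forall x y,
    x \notin del st -> y \notin del st -> color H x = color H y}.
  by apply: mono; rewrite (perm_mem vsV) mem_enum.
have {}len : (n <= 20 * (\sum_(v : V) deg H v + #|[set v | deg H v == 0%N]|))%N.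
  apply: leq_trans len _; rewrite (perm_big _ vsV) big_enum /=.
  rewrite -sum1_card [X in (_ + X)%N]big_mkcond -big_split big_distrr /=.
  by apply: leq_sum => v _; rewrite inE; case: eqP; lia.
split; [by exists (del st), n, st| |exact: sum_deg].
move=> D t [st' ex' ->]; have [<- <-] := exec_nodes_det ex ex'; split=> //.
- move=> e f eD fD; rewrite /bad_pair negb_and -implybE negbK.
  apply/implyP => /set0Pn[v]; rewrite !inE => /andP[ve vf].
  by apply/eqP/(mono v); rewrite ?inE.
- exact: monochromatic_coloring.
(* [OPT H] is by definition the unsatisfied weight of a minimizing coloring, so the bound is taken
   at that [phi]. *)
- exact: ratio_inv_bound inv.
- move=> deg_gt0; apply: leq_trans len _.
  rewrite (_ : [set v | _] = set0) ?cards0 ?addn0 //.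
  by apply/setP => v; rewrite !inE eqn0Ngt deg_gt0.
Qed.
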